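(* Let $y=y(x)$, $u=u(x)$ be a smooth curve in the contact space $W=\mathbb{R}^3(x,y,u)$ and let $A_1=(x,y,u)$ be a point on it at which $xy_x-y\ne0$. Let $A_0,A_2$ be points of the curve with $x$-coordinates $x-\delta$ and $x+\epsilon$, $\delta,\epsilon>0$. Put $$I_1=\frac{u_x-y}{xy_x-y},\qquad I_2=\frac{(xy-2u)^2}{(xy_x-y)^3}\,y_{xx},\qquad \nabla=\frac{xy-2u}{xy_x-y}\,\mathcal{D}_x .$$ Then, with all these expressions evaluated at $A_1$ along the curve, $$I_1=\lim_{A_0\to A_1}\frac{R_0-R_1}{2R_{01}}+\frac12,\qquad \frac12 I_2=\lim_{A_0,A_2\to A_1}\frac{R_1^2\,(R_{01}+R_{12}-R_{02})}{R_{01}R_{02}R_{12}},\qquad \nabla=\lim_{A_0\to A_1}\frac{R_1}{R_{01}}\,\overrightarrow{A_0A_1}.$$ Equivalently, when $R_1\neq0$ and with $T_i=R_i/R_1$, $T_{ij}=R_{ij}/R_1$, $$I_1=\lim_{A_0\to A_1}\frac{T_0-1+T_{01}}{2T_{01}},\qquad \frac12 I_2=\lim_{A_0,A_2\to A_1}\frac{T_{01}+T_{12}-T_{02}}{T_{01}T_{02}T_{12}},\qquad \nabla=\lim_{A_0\to A_1}\frac{\overrightarrow{A_0A_1}}{T_{01}}.$$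
   Context: Write $A_i=(x_i,y_i,u_i)$, $i=0,1,2$, with $(x_1,y_1,u_1)=(x,y,u)$, $x_0=x-\delta$, $x_2=x+\epsilon$; the limits are taken as $\delta,\epsilon\to0$ independently. Define $R_i=x_iy_i-2u_i$ and $R_{ij}=x_iy_j-x_jy_i$. Subscripts $x$ denote derivatives along the curve. Along the curve the total derivative $\mathcal{D}_x$ is identified with the tangent vector $\partial_x+y_x\partial_y+u_x\partial_u$. *)

(* Defs.v *)
From HB Require Import structures.
From mathcomp Require Import all_boot all_order all_algebra.
From mathcomp Require Import all_classical all_reals all_analysis.

Set Implicit Arguments.
Unset Strict Implicit.
Unset Printing Implicit Defensive.

Import Order.TTheory GRing.Theory Num.Theory.
Import numFieldNormedType.Exports.

Local Open Scope classical_set_scope.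
Local Open Scope ring_scope.

(* Smoothness on an open set D. The iterated derivative f^`(n) at a point of D
   only depends on f near that point, so the values of f outside D are
   irrelevant. *)
Definition smooth_on (R : realType) (D : set R) (f : R -> R) : Prop :=
  forall n x, D x -> derivable f^`(n)%classic x 1.

(* Points and vectors of W = R^3(x, y, u) are rows (x, y, u). *)
Definition xcoord (R : realType) (A : 'rV[R]_3) : R := A 0 0.
Definition ycoord (R : realType) (A : 'rV[R]_3) : R := A 0 1.
Definition ucoord (R : realType) (A : 'rV[R]_3) : R := A 0 2.

Definition partial_x (R : realType) : 'rV[R]_3 := delta_mx 0 0.
Definition partial_y (R : realType) : 'rV[R]_3 := delta_mx 0 1.
Definition partial_u (R : realType) : 'rV[R]_3 := delta_mx 0 2.

Definition curve_point (R : realType) (y u : R -> R) (x : R) : 'rV[R]_3 :=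
  \row_j [:: x; y x; u x]`_j.

(* R_i = Rone A_i and R_ij = Rtwo A_i A_j. *)
Definition Rone (R : realType) (A : 'rV[R]_3) : R :=
  xcoord A * ycoord A - 2 * ucoord A.

Definition Rtwo (R : realType) (A B : 'rV[R]_3) : R :=
  xcoord A * ycoord B - xcoord B * ycoord A.

(* T_i = Tone A_1 A_i and T_ij = Ttwo A_1 A_i A_j: the same quantities
   normalised by R_1. *)
Definition Tone (R : realType) (A1 A : 'rV[R]_3) : R := Rone A / Rone A1.

Definition Ttwo (R : realType) (A1 A B : 'rV[R]_3) : R := Rtwo A B / Rone A1.

Definition I_one (R : realType) (y u : R -> R) (x : R) : R :=
  (u^`()%classic x - y x) / (x * y^`()%classic x - y x).

Definition I_two (R : realType) (y u : R -> R) (x : R) : R :=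
  (x * y x - 2 * u x) ^+ 2 / (x * y^`()%classic x - y x) ^+ 3 * y^`(2)%classic x.

(* The total derivative along the curve, as the tangent vector of the curve. *)
Definition total_derivative (R : realType) (y u : R -> R) (x : R) : 'rV[R]_3 :=
  partial_x R + y^`()%classic x *: partial_y R + u^`()%classic x *: partial_u R.

Definition nabla (R : realType) (y u : R -> R) (x : R) : 'rV[R]_3 :=
  ((x * y x - 2 * u x) / (x * y^`()%classic x - y x)) *: total_derivative y u x.

(* Main.v *)
(** Write [y (x - d) = y x - d a], [y (x + e) = y x + e b] with [a], [b] the
    one-sided difference quotients.  Then [R01 = d (x a - y)],
    [R12 = e (x b - y)], while [R01 + R12 - R02], twice the signed area of the
    projected triangle [A0 A1 A2], equals [d e (b - a)], and
    [R02 / (d + e) -> x y' - y].  Everything thus reduces to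
    [(b - a) / (d + e) -> y'' / 2] as [d], [e] tend to 0 independently: this
    quotient is the average, with weights [d] and [e], of the second order
    Taylor quotients at [- d] and [e], so Taylor's formula at [x] suffices. *)
Require Import Defs.
From HB Require Import structures.
From mathcomp Require Import all_boot all_order all_algebra.
From mathcomp Require Import all_classical all_reals all_analysis.
From mathcomp Require Import ring.
Import Order.TTheory GRing.Theory Num.Theory.
Import numFieldNormedType.Exports.
Local Open Scope classical_set_scope.
Local Open Scope ring_scope.

Set Implicit Arguments.
Unset Strict Implicit.

(** * Limits along a product of two filters *)

Section filter_prod.
Context {T U V : Type} {F : set_system T} {G : set_system U}.
Context {FF : Filter F} {FG : Filter G}.

Lemma near_fst (P : set T) :
  (\forall t \near F, P t) -> \forall p \near filter_prod F G, P p.1.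
Proof. exact: cvg_fst. Qed.

Lemma near_snd (P : set U) :
  (\forall t \near G, P t) -> \forall p \near filter_prod F G, P p.2.
Proof. exact: cvg_snd. Qed.

Lemma cvg_comp_fst (f : T -> V) (L : set_system V) :
  f @ F --> L -> f p.1 @[p --> filter_prod F G] --> L.
Proof. by move=> fL A /fL; exact: near_fst. Qed.

Lemma cvg_comp_snd (g : U -> V) (L : set_system V) :
  g @ G --> L -> g p.2 @[p --> filter_prod F G] --> L.
Proof. by move=> gL A /gL; exact: near_snd. Qed.

End filter_prod.

(** The distance from the combination to [l] is at most the same combination of the distances of [f]
    and [g] to [l]. The weight [w] may oscillate: as d and e tend to 0 independently, d / (d + e)
    has no limit, only bounds. *)
Lemma cvg_convex_comb {R : realType} {T : Type} {F : set_system T} {FF : Filter F}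
    (f g w : T -> R) (l : R) :
  f @ F --> l -> g @ F --> l -> (\forall t \near F, 0 <= w t <= 1) ->
  w t * f t + (1 - w t) * g t @[t --> F] --> l.
Proof.
move=> fl gl w01; apply/cvgrPdist_le => e e0.
near=> t.
have /andP[w0 w1] : 0 <= w t <= 1 by near: t.
have fe : `|l - f t| <= e by near: t; move/cvgrPdist_le : fl; apply.
have ge : `|l - g t| <= e by near: t; move/cvgrPdist_le : gl; apply.
have -> : l - (w t * f t + (1 - w t) * g t) =
    w t * (l - f t) + (1 - w t) * (l - g t) by ring.
rewrite (le_trans (ler_normD _ _))// !normrM (ger0_norm w0).
rewrite (ger0_norm (_ : 0 <= 1 - w t)) ?subr_ge0//.
have -> : e = w t * e + (1 - w t) * e by ring.
by apply: lerD; apply: ler_wpM2l; rewrite // subr_ge0.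
Unshelve. all: by end_near. Qed.

Lemma near_barycenter {R : realType} :
  \forall p \near filter_prod (0:R)^'+ (0:R)^'+, 0 <= p.1 / (p.1 + p.2) <= 1.
Proof.
near=> p.
have p10 : 0 < p.1 by near: p; exact: near_fst (nbhs_right_gt _).
have p20 : 0 < p.2 by near: p; exact: near_snd (nbhs_right_gt _).
have p120 : 0 < p.1 + p.2 by exact: addr_gt0.
by rewrite ler_pdivlMr// ler_pdivrMr// mul0r mul1r lerDl !ltW.
Unshelve. all: by end_near. Qed.

(** * Difference quotients and Taylor's formula of order two *)

Section taylor.
Context {R : realType}.
Implicit Types (f : R -> R) (x : R).

Lemma cvg_diff_quotient f x : derivable f x 1 ->
  (f (x + h) - f x) / h @[h --> 0^'] --> f^`()%classic x.
Proof.
move=> df; rewrite derive1E.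
have := df; rewrite /derivable /derive.
rewrite (_ : (fun h => _) = (fun h => (f (x + h) - f x) / h))//.
by apply/funext => h /=; rewrite [_ *: 1]mulr1 [_ *: _]mulrC [h + x]addrC.
Qed.

Lemma cvg_dnbhs0_at_right_opp f (l : R) :
  f h @[h --> 0^'] --> l -> f (- h) @[h --> 0^'+] --> l.
Proof.
by move=> /cvg_dnbhs_at_left /cvg_at_leftNP; rewrite oppr0.
Qed.

(** One application of l'Hôpital's rule to the remainder [F] over [G], the square: the quotient of
    the derivatives is half the difference quotient of f' at [x], which converges by derivability of
    f' at that point. *)
Lemma cvg_taylor2 f x : (\forall t \near x, derivable f t 1) ->
  derivable f^`()%classic x 1 ->
  (f (x + h) - f x - h * f^`()%classic x) / h ^+ 2 @[h --> 0^'] -->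
    f^`(2)%classic x / 2.
Proof.
move=> [r /= r0 dfr] d2f.
set c := f^`()%classic x; set l := f^`(2)%classic x / 2.
pose F h := f (x + h) - f x - h * c.
pose G (h : R) := h ^+ 2.
have dF h : h \in `](- r), r[ -> is_derive h 1 F (f^`()%classic (x + h) - c).
  rewrite in_itv/= => /andP[rh hr].
  have dfh : derivable f (x + h) 1.
    by apply: dfr => /=; rewrite opprD addNKr normrN ltr_norml rh.
  have dfh' : is_derive (shift x h) 1 f (f^`()%classic (x + h)).
    by rewrite /= [h + x]addrC derive1E; apply: DeriveDef.
  have -> : F = (f \o shift x) - cst (f x) - (c \*: id).
    by apply/funext => t; rewrite /F !fctE /= [t + x]addrC [_ * c]mulrC.
  have := is_derive1_comp dfh' (is_derive_shift _ _ _) => dfs.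
  by apply: is_derive_eq; rewrite mulr1 subr0 [_ *: 1]mulr1.
have dG (h : R) : is_derive h 1 G (2 * h).
  have -> : G = id ^+ 2 by apply/funext => t; rewrite /G !fctE.
  by apply: is_derive_eq; rewrite /= expr1 [_ *: 1]mulr1.
have F0 : F h @[h --> 0] --> 0.
  have F00 : F 0 = 0 by rewrite /F addr0 subrr mul0r subrr.
  rewrite -[X in _ --> X]F00.
  have := dF 0; rewrite in_itv/= oppr_lt0 r0 => /(_ isT) [+ _].
  by move=> /derivable1_diffP /differentiable_continuous.
have G0 : G h @[h --> 0] --> 0.
  have G00 : G 0 = 0 by rewrite /G expr0n.
  rewrite -[X in _ --> X]G00.
  by have [+ _] := dG 0; move=> /derivable1_diffP /differentiable_continuous.
have q : (f^`()%classic (x + h) - c) / (2 * h) @[h --> 0^'] --> l.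
  rewrite /l derive1nS derive1n1.
  rewrite (_ : (fun h => _) = fun h => (f^`()%classic (x + h) - c) / h / 2).
    by apply: cvgM _ (cvg_cst _); exact: cvg_diff_quotient.
  by apply/funext => h; rewrite invfM mulrA mulrAC.
pose F' h := f^`()%classic (x + h) - c.
pose G' (h : R) := 2 * h.
(* The rule is applied on each side of 0 separately, and the two one-sided limits are glued at the
   end. *)
have right : F h / G h @[h --> 0^'+] --> l.
  have Fr : F h @[h --> 0^'+] --> 0 by exact: cvg_at_right_filter.
  have Gr : G h @[h --> 0^'+] --> 0 by exact: cvg_at_right_filter.
  have G'r h : h \in `]0, r[ -> G' h != 0.
    by rewrite in_itv/= => /andP[h0 _]; rewrite mulf_neq0// gt_eqF.
  have dFr h : h \in `]0, r[ -> is_derive h 1 F (F' h).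
    rewrite in_itv/= => /andP[h0 hr]; apply: dF.
    by rewrite in_itv/= hr (lt_trans _ h0)// oppr_lt0.
  exact: (@lhopital_at_right R F F' G G' _ _ l r0 dFr (fun h _ => dG h)
    Fr Gr G'r (cvg_dnbhs_at_right q)).
have Nr0 : - r < 0 by rewrite oppr_lt0.
have left : F h / G h @[h --> 0^'-] --> l.
  have Fr : F h @[h --> 0^'-] --> 0 by exact: cvg_at_left_filter.
  have Gr : G h @[h --> 0^'-] --> 0 by exact: cvg_at_left_filter.
  have G'r h : h \in `](- r), 0[ -> G' h != 0.
    by rewrite in_itv/= => /andP[_ h0]; rewrite mulf_neq0// lt_eqF.
  have dFr h : h \in `](- r), 0[ -> is_derive h 1 F (F' h).
    rewrite in_itv/= => /andP[h0 hr]; apply: dF.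
    by rewrite in_itv/= h0 (lt_trans hr).
  exact: (@lhopital_at_left R F F' G G' _ _ l Nr0 dFr (fun h _ => dG h)
    Fr Gr G'r (cvg_dnbhs_at_left q)).
exact: (@cvg_at_right_left_dnbhs _ R^o).
Qed.

Lemma cvg_diff_quotient_right f x : derivable f x 1 ->
  (f (x + h) - f x) / h @[h --> 0^'+] --> f^`()%classic x.
Proof. by move=> /cvg_diff_quotient /cvg_dnbhs_at_right. Qed.

Lemma cvg_diff_quotient_left f x : derivable f x 1 ->
  (f x - f (x - h)) / h @[h --> 0^'+] --> f^`()%classic x.
Proof.
move=> /cvg_diff_quotient /cvg_dnbhs0_at_right_opp.
rewrite [X in X @ _ --> _](_ : _ = fun h => (f x - f (x - h)) / h)//.
by apply/funext => h; rewrite invrN mulrN -mulNr opprB.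
Qed.

Lemma cvg_divided_difference2 f x : (\forall t \near x, derivable f t 1) ->
  derivable f^`()%classic x 1 ->
  ((f (x + p.2) - f x) / p.2 - (f x - f (x - p.1)) / p.1) / (p.1 + p.2)
    @[p --> filter_prod 0^'+ 0^'+] --> f^`(2)%classic x / 2.
Proof.
move=> df d2f; have tf := cvg_taylor2 df d2f.
set s := (X in X @ _ --> _) in tf.
have s1 : s (- p.1) @[p --> filter_prod (0:R)^'+ (0:R)^'+] -->
    f^`(2)%classic x / 2.
  exact: (cvg_comp_fst (cvg_dnbhs0_at_right_opp tf)).
have s2 : s p.2 @[p --> filter_prod (0:R)^'+ (0:R)^'+] -->
    f^`(2)%classic x / 2.
  exact: (cvg_comp_snd (cvg_dnbhs_at_right tf)).
have p1 : \forall p \near filter_prod (0:R)^'+ (0:R)^'+, 0 < p.1.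
  exact: near_fst (nbhs_right_gt _).
have p2 : \forall p \near filter_prod (0:R)^'+ (0:R)^'+, 0 < p.2.
  exact: near_snd (nbhs_right_gt _).
(* With a and b the left and right quotients, d s(-d) = f'(x) - a and e s(e) = b - f'(x). Adding
   cancels f'(x), so (b - a) / (d + e) is the combination of s(-d) and s(e) with weights d / (d + e)
   and e / (d + e). *)
apply: cvg_trans (cvg_convex_comb s1 s2 near_barycenter).
apply: near_eq_cvg; near=> p.
have p10 : p.1 != 0 by rewrite gt_eqF//; near: p.
have p20 : p.2 != 0 by rewrite gt_eqF//; near: p.
have p120 : p.1 + p.2 != 0.
  by rewrite gt_eqF// addr_gt0//; near: p.
rewrite /s; move: (p.1) (p.2) p10 p20 p120 => d e d0 e0 de0.
by field; rewrite d0 e0 de0.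
Unshelve. all: by end_near. Qed.

End taylor.

Section curve_point.
Context {R : realType}.
Implicit Types (y u : R -> R) (s t : R).

Lemma Rone_curve_point y u t :
  Rone (curve_point y u t) = t * y t - 2 * u t.
Proof. by rewrite /Rone /xcoord /ycoord /ucoord !mxE. Qed.

Lemma Rtwo_curve_point y u s t :
  Rtwo (curve_point y u s) (curve_point y u t) = s * y t - t * y s.
Proof. by rewrite /Rtwo /xcoord /ycoord !mxE. Qed.

End curve_point.

Theorem mainTheorem9 (R : realType) (D : set R) (y u : R -> R) (x : R)
    (D_open : open D) (D_itv : is_interval D) (Dx : D x)
    (y_smooth : smooth_on D y) (u_smooth : smooth_on D u)
    (regular : x * y^`()%classic x - y x != 0) :
  let A1 := curve_point y u x in
  let A0 := fun delta : R => curve_point y u (x - delta) in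
  let A2 := fun epsilon : R => curve_point y u (x + epsilon) in
  [/\ (Rone (A0 d) - Rone A1) / (2 * Rtwo (A0 d) A1) @[d --> 0^'+]
        --> I_one y u x - 1 / 2,
      Rone A1 ^+ 2
        * (Rtwo (A0 p.1) A1 + Rtwo A1 (A2 p.2) - Rtwo (A0 p.1) (A2 p.2))
        / (Rtwo (A0 p.1) A1 * Rtwo (A0 p.1) (A2 p.2) * Rtwo A1 (A2 p.2))
        @[p --> filter_prod 0^'+ 0^'+]
        --> 1 / 2 * I_two y u x
    & (Rone A1 / Rtwo (A0 d) A1) *: (A1 - A0 d) @[d --> 0^'+]
        --> nabla y u x]
  /\
  (Rone A1 != 0 ->
   [/\ (Tone A1 (A0 d) - 1 + Ttwo A1 (A0 d) A1) / (2 * Ttwo A1 (A0 d) A1)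
         @[d --> 0^'+]
         --> I_one y u x,
       (Ttwo A1 (A0 p.1) A1 + Ttwo A1 A1 (A2 p.2) - Ttwo A1 (A0 p.1) (A2 p.2))
         / (Ttwo A1 (A0 p.1) A1 * Ttwo A1 (A0 p.1) (A2 p.2)
              * Ttwo A1 A1 (A2 p.2))
         @[p --> filter_prod 0^'+ 0^'+]
         --> 1 / 2 * I_two y u x
     & (Ttwo A1 (A0 d) A1)^-1 *: (A1 - A0 d) @[d --> 0^'+]
         --> nabla y u x]).
Proof.
move=> A1 A0 A2.
have nD : \forall t \near x, D t by exact: open_nbhs_nbhs.
have dy : \forall t \near x, derivable y t 1.
  by apply: filterS nD => t Dt; exact: (y_smooth 0%N).
have d2y : derivable y^`()%classic x 1 by exact: (y_smooth 1%N).
have dyx : derivable y x 1 by exact: (y_smooth 0%N).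
have dux : derivable u x 1 by exact: (u_smooth 0%N).
set Y := y^`()%classic x in regular *.
set U := u^`()%classic x in regular *.

(* Difference quotients along the curve *)
pose a d := (y x - y (x - d)) / d.
pose b e := (y (x + e) - y x) / e.
pose v d := (u x - u (x - d)) / d.
have aY : a d @[d --> 0^'+] --> Y by exact: cvg_diff_quotient_left.
have bY : b e @[e --> 0^'+] --> Y by exact: cvg_diff_quotient_right.
have vU : v d @[d --> 0^'+] --> U by exact: cvg_diff_quotient_left.
have id0 : d @[d --> (0:R)^'+] --> (0:R).
  by apply: cvg_at_right_filter; exact: cvg_id.
have PY : x * a d - y x @[d --> 0^'+] --> x * Y - y x.
  by apply: cvgB (cvg_cst _); exact: cvgM (cvg_cst _) _.
have QY : x * b e - y x @[e --> 0^'+] --> x * Y - y x.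
  by apply: cvgB (cvg_cst _); exact: cvgM (cvg_cst _) _.
(* By [regular] the limits are nonzero, so R01 / d and R12 / e do not vanish for small increments
   and may be cleared by [field]. *)
have P0 : \forall d \near 0^'+, x * a d - y x != 0.
  by exact: (cvgr_neq0 _ PY).
have Q0 : \forall e \near 0^'+, x * b e - y x != 0.
  by exact: (cvgr_neq0 _ QY).
have yE (d : R) : d != 0 -> y (x - d) = y x - d * a d.
  by move=> d0; rewrite /a mulrC divfK// subKr.
have uE (d : R) : d != 0 -> u (x - d) = u x - d * v d.
  by move=> d0; rewrite /v mulrC divfK// subKr.
have yE2 (d : R) : d != 0 -> y (x + d) = y x + d * b d.
  by move=> d0; rewrite /b mulrC divfK// subrKC.
have R01E (d : R) : d != 0 -> Rtwo (A0 d) A1 = d * (x * a d - y x).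
  by move=> d0; rewrite Rtwo_curve_point yE//; ring.
have R12E (e : R) : e != 0 -> Rtwo A1 (A2 e) = e * (x * b e - y x).
  by move=> e0; rewrite Rtwo_curve_point yE2//; ring.

(* The limit giving I_1 *)
have lim1 : (Rone (A0 d) - Rone A1) / (2 * Rtwo (A0 d) A1) @[d --> 0^'+]
    --> I_one y u x - 1 / 2.
  (* The numerator is the limit of (R0 - R1) / d = 2 v - y - x a + d a; the term [0 * Y] is kept as
     the limit of [d * a d]. *)
  have -> : I_one y u x - 1 / 2 =
      (2 * U - y x - x * Y + 0 * Y) / (2 * (x * Y - y x)).
    by rewrite /I_one -/Y -/U; field.
  have N : 2 * v d - y x - x * a d + d * a d @[d --> 0^'+]
      --> 2 * U - y x - x * Y + 0 * Y.
    apply: cvgD (cvgM id0 aY); apply: cvgB (cvgM (cvg_cst _) aY).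
    exact: cvgB (cvgM (cvg_cst _) vU) (cvg_cst _).
  have denom_neq0 : 2 * (x * Y - y x) != 0 by rewrite mulf_neq0.
  have L : (2 * v d - y x - x * a d + d * a d) / (2 * (x * a d - y x))
      @[d --> 0^'+] --> (2 * U - y x - x * Y + 0 * Y) / (2 * (x * Y - y x)).
    apply: cvgM; first exact: N.
    apply: cvgV; first exact: denom_neq0.
    apply: cvgM; last exact: PY.
    exact: cvg_cst.
  apply: cvg_trans L.
  apply: near_eq_cvg; near=> d.
  have d0 : d != 0 by near: d; exact: nbhs_right_neq.
  have Pd : x * a d - y x != 0 by near: d.
  rewrite R01E// !Rone_curve_point yE// uE//.
  by field; rewrite Pd d0.

(* The limit giving I_2 *)
have lim2 : Rone A1 ^+ 2
        * (Rtwo (A0 p.1) A1 + Rtwo A1 (A2 p.2) - Rtwo (A0 p.1) (A2 p.2))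
        / (Rtwo (A0 p.1) A1 * Rtwo (A0 p.1) (A2 p.2) * Rtwo A1 (A2 p.2))
        @[p --> filter_prod 0^'+ 0^'+]
        --> 1 / 2 * I_two y u x.
  pose F := filter_prod (0:R)^'+ (0:R)^'+.
  pose q (p : R * R) := (b p.2 - a p.1) / (p.1 + p.2).
  pose w (p : R * R) := p.1 / (p.1 + p.2).
  (* [M p] is R02 / (d + e). Its first term involves a weighted mean of [a] and [b], which share the
     limit [Y]; its last term vanishes in the limit because [q] stays convergent. *)
  pose M p := x * (w p * a p.1 + (1 - w p) * b p.2) - y x - p.1 * p.2 * q p.
  have qF : q @ F --> y^`(2)%classic x / 2 by exact: cvg_divided_difference2.
  have p1F : p.1 @[p --> F] --> (0:R) by exact: cvg_comp_fst id0.
  have p2F : p.2 @[p --> F] --> (0:R) by exact: cvg_comp_snd id0.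
  have MF : M @ F --> x * Y - y x.
    rewrite -[X in _ --> X](_ : x * Y - y x - 0 * 0 * (y^`(2)%classic x / 2) = _).
      apply: cvgB (cvgM (cvgM p1F p2F) qF).
      apply: cvgB (cvg_cst _); apply: cvgM (cvg_cst _) _.
      apply: cvg_convex_comb (cvg_comp_fst aY) (cvg_comp_snd bY) _.
      exact: near_barycenter.
    by rewrite !mul0r subr0.
  have -> : 1 / 2 * I_two y u x = Rone A1 ^+ 2 * (y^`(2)%classic x / 2) /
      ((x * Y - y x) * (x * Y - y x) * (x * Y - y x)).
    rewrite /I_two -/Y !Rone_curve_point.
    by field.
  have denom_neq0 : (x * Y - y x) * (x * Y - y x) * (x * Y - y x) != 0.
    by rewrite !mulf_neq0.
  (* The factor d e (d + e) is common to R01 + R12 - R02 and to R01 R02 R12. Cancelling it leaves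
     R1^2 q over the product of (x a - y), [M p] and (x b - y). *)
  apply: cvg_trans (cvgM (cvgM (cvg_cst (Rone A1 ^+ 2)) qF)
    (cvgV denom_neq0 (cvgM (cvgM (cvg_comp_fst PY) MF) (cvg_comp_snd QY)))).
  apply: near_eq_cvg; near=> p.
  have p10 : 0 < p.1 by near: p; exact: near_fst (nbhs_right_gt _).
  have p20 : 0 < p.2 by near: p; exact: near_snd (nbhs_right_gt _).
  have Pp : x * a p.1 - y x != 0 by near: p; exact: near_fst P0.
  have Qp : x * b p.2 - y x != 0 by near: p; exact: near_snd Q0.
  have Mp : M p != 0 by near: p; exact: (cvgr_neq0 _ MF).
  have p12 : p.1 + p.2 != 0 by rewrite gt_eqF// addr_gt0.
  have d0 : p.1 != 0 by rewrite gt_eqF.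
  have e0 : p.2 != 0 by rewrite gt_eqF.
  have R02E : Rtwo (A0 p.1) (A2 p.2) = (p.1 + p.2) * M p.
    rewrite Rtwo_curve_point yE// yE2// /M /q /w.
    by move: (p.1) (p.2) p12 => d e de0; field.
  have -> : Rtwo (A0 p.1) A1 + Rtwo A1 (A2 p.2) - Rtwo (A0 p.1) (A2 p.2) =
      p.1 * p.2 * (p.1 + p.2) * q p.
    rewrite R02E R01E// R12E// /M /q /w.
    by move: (p.1) (p.2) p12 => d e de0; field.
  rewrite R02E R01E// R12E//=.
  move: (M p) (q p) (p.1) (p.2) Mp p12 d0 e0 Pp Qp => m r d e m0 de0 d0 e0 P Q.
  by field; rewrite m0 de0 d0 e0 P Q.

(* The limit giving nabla *)
have lim3 : (Rone A1 / Rtwo (A0 d) A1) *: (A1 - A0 d) @[d --> 0^'+]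
        --> nabla y u x.
  rewrite (_ : nabla y u x = (Rone A1 / (x * Y - y x)) *:
    (partial_x R + Y *: partial_y R + U *: partial_u R)); last first.
    by rewrite /nabla /total_derivative Rone_curve_point.
  have W : partial_x R + a d *: partial_y R + v d *: partial_u R
      @[d --> 0^'+] --> partial_x R + Y *: partial_y R + U *: partial_u R.
    apply: cvgD (cvgZ vU (cvg_cst _)); apply: cvgD (cvg_cst _) _.
    exact: cvgZ aY (cvg_cst _).
  apply: cvg_trans (cvgZ (cvgM (cvg_cst (Rone A1)) (cvgV regular PY)) W).
  apply: near_eq_cvg; near=> d.
  have d0 : d != 0 by near: d; exact: nbhs_right_neq.
  have Pd : x * a d - y x != 0 by near: d.
  (* The chord divided by d is the tangent vector with derivatives replaced by difference quotients;
     this d cancels the one in R01. *)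
  have -> : A1 - A0 d =
      d *: (partial_x R + a d *: partial_y R + v d *: partial_u R).
    apply/rowP; case=> [[|[|[|//]]] i3]; rewrite !mxE/= ?yE// ?uE//; ring.
  rewrite R01E// scalerA; congr (_ *: _).
  by rewrite /= /unstable.inv_fun; field; rewrite Pd d0.

(* The normalised forms *)
split=> // R1; split.
- rewrite -[I_one y u x](subrK (1 / 2)).
  have L : (Rone (A0 d) - Rone A1) / (2 * Rtwo (A0 d) A1) + 1 / 2 @[d --> 0^'+]
      --> I_one y u x - 1 / 2 + 1 / 2.
    by apply: cvgD; [exact: lim1|exact: cvg_cst].
  apply: cvg_trans L.
  apply: near_eq_cvg; near=> d.
  have d0 : d != 0 by near: d; exact: nbhs_right_neq.
  have Pd : x * a d - y x != 0 by near: d.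
  have R01 : Rtwo (A0 d) A1 != 0 by rewrite R01E// mulf_neq0.
  by rewrite /Tone /Ttwo /=; field; rewrite R1 R01.
- apply: cvg_trans lim2; apply: near_eq_cvg; near=> p.
  (* One factor 1 / R1 above and three below leave R1^2. The inverses of the R_ij are kept as atoms,
     so only R1 has to be cleared. *)
  rewrite /Ttwo -mulrDl -mulrBl !invfM !invrK.
  set N := _ + _ - _; set r01 := (Rtwo (A0 _) A1)^-1.
  set r02 := (Rtwo (A0 _) (A2 _))^-1; set r12 := (Rtwo A1 _)^-1.
  by field.
- rewrite (_ : (fun d => _) = fun d => (Rone A1 / Rtwo (A0 d) A1) *: (A1 - A0 d))//.
  by apply/funext => d; rewrite /Ttwo invf_div.
Unshelve. all: by end_near. Qed.
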